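(* Let $(X,d)$ be a compact metric space, $T\colon X\to X$ a homeomorphism, and $\alpha>0$. The following conditions are equivalent. (1) $T$ is expansive with expansivity constant $\alpha$. (2) For every $\varepsilon>0$ there exists $\delta>0$ such that for every pair of $\delta$-pseudo orbits $(x_n)_{n\in\mathbb Z}$ and $(y_n)_{n\in\mathbb Z}$ of $T$: if $d(x_n,y_n)\leq\alpha$ for all $n\in\mathbb Z$, then $d(x_n,y_n)<\varepsilon$ for all $n\in\mathbb Z$.
   Context: $T$ is expansive with expansivity constant $\alpha>0$ if, whenever $x,y\in X$ satisfy $d(T^nx,T^ny)\leq\alpha$ for all $n\in\mathbb Z$, one has $x=y$. For $\delta>0$, a $\delta$-pseudo orbit of $T$ is a bi-sequence $(x_n)_{n\in\mathbb Z}$ of elements of $X$ such that $d(Tx_n,x_{n+1})<\delta$ for all $n\in\mathbb Z$. *)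

(* Defs.v *)
From HB Require Import structures.
From mathcomp Require Import all_boot all_order all_algebra.
From mathcomp Require Import all_classical all_reals all_analysis.

Set Implicit Arguments.
Unset Strict Implicit.
Unset Printing Implicit Defensive.

Import Order.TTheory GRing.Theory Num.Theory.

Local Open Scope classical_set_scope.
Local Open Scope ring_scope.

(* A {splitbij [set: X] >-> [set: X]} is a bijection of the whole type X bundled
   with its two-sided inverse T^-1. *)
Definition homeomorphism (X : topologicalType)
    (T : {splitbij [set: X] >-> [set: X]}) : Prop :=
  continuous T /\ continuous (T^-1)%FUN.

(* Negz m is the integer - m.+1. *)
Definition iterz (X : Type) (T : {splitbij [set: X] >-> [set: X]})
    (n : int) : X -> X :=
  match n with
  | Posz m => iter m T
  | Negz m => iter m.+1 (T^-1)%FUN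
  end.

Lemma iterzS (X : Type) (T : {splitbij [set: X] >-> [set: X]}) (n : int) (x : X) :
  iterz T (n + 1) x = T (iterz T n x).
Proof.
case: n => [m|[|m]]; first by rewrite -PoszD addn1.
  by rewrite /= invK ?inE.
have -> : Negz m.+1 + 1 = Negz m by rewrite !NegzE [X in - X]intS opprD addrAC addNr add0r.
by rewrite [in RHS]/iterz iterS invK ?inE.
Qed.

Definition expansive (R : realType) (X : metricType R)
    (T : {splitbij [set: X] >-> [set: X]}) (alpha : R) : Prop :=
  forall x y : X,
    (forall n : int, mdist (iterz T n x) (iterz T n y) <= alpha) -> x = y.

Definition pseudo_orbit (R : realType) (X : metricType R)
    (T : X -> X) (delta : R) (x : int -> X) : Prop :=
  forall n : int, mdist (T (x n)) (x (n + 1)) < delta.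

(* Main.v *)
Require Import Defs.
From mathcomp Require Import all_boot all_order all_algebra.
From mathcomp Require Import all_classical all_reals all_analysis.
From mathcomp Require Import lra.

Import Order.TTheory GRing.Theory Num.Theory.
Import numFieldNormedType.Exports.

Local Open Scope classical_set_scope.
Local Open Scope ring_scope.

(** The implication from (2) to (1) holds because a genuine orbit is a
    [delta]-pseudo orbit for every [delta]: two orbits that stay
    [alpha]-close are [eps]-close for every [eps], hence equal.

    For the converse, suppose that some [eps] admits no [delta]. Then for
    every [delta] there are two [delta]-pseudo orbits, [alpha]-close at all
    times and [eps]-apart at some time; pseudo orbits are stable under a shift
    of time, so that this time may be taken to be [0]. Such pairs are
    points of the product of copies of [X * X] indexed by the integers,
    which is compact by Tychonoff's theorem. The conditions that define them
    are closed once the strict inequality in the notion of pseudo orbit is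
    weakened to a large one, and they get stronger as [delta] decreases. By
    compactness a single pair satisfies them for all [delta]
    ([orbit_pair_of_pseudo_orbit_pairs]). It consists of two genuine orbits,
    [alpha]-close at all times and distinct at time [0], against
    expansivity. *)

Section MetricContinuity.
Context {R : realType} {X : metricType R}.

Lemma mdist_continuous : continuous (fun p : X * X => mdist p.1 p.2).
Proof.
move=> [a b]; apply/cvgrPdist_lt => e e0.
have e20 : 0 < e / 2 by rewrite divr_gt0.
exists (ball a (e / 2), ball b (e / 2)); first by split; exact: nbhsx_ballx.
move=> [c d] [] /=; rewrite !ballEmdist /= => ac bd.
have := metric_triangle a c b; have := metric_triangle c d b.
have := metric_triangle c a d; have := metric_triangle a b d.
rewrite (metric_sym c a) (metric_sym d b) ltr_norml => h1 h2 h3 h4.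
by apply/andP; split; lra.
Qed.

Lemma continuous_mdist {U : topologicalType} (f g : U -> X) :
  continuous f -> continuous g -> continuous (fun u => mdist (f u) (g u)).
Proof.
move=> fc gc u; apply: (@continuous_comp _ _ _ (fun u => (f u, g u))
    (fun p : X * X => mdist p.1 p.2)).
  by apply: cvg_pair; [exact: fc | exact: gc].
exact: mdist_continuous.
Qed.

End MetricContinuity.

(** The sets [A d], [0 < d], form a filter base; compactness gives a cluster
    point of the filter, which lies in the closure of each of them. *)
Lemma compact_nested_nonempty {R : realType} {U : topologicalType}
    (A : R -> set U) :
  compact [set: U] ->
  (forall d, 0 < d -> closed (A d)) -> (forall d, 0 < d -> A d !=set0) ->
  (forall d d', d <= d' -> A d `<=` A d') ->
  exists u, forall d, 0 < d -> A d u.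
Proof.
move=> cptU Acl An0 Amono.
pose F := filter_from [set d : R | 0 < d] A.
have FF : ProperFilter F.
  apply: filter_from_proper => //; apply: filter_from_filter.
    by exists 1 => /=.
  move=> i j /= i0 j0; exists (Num.min i j); first by rewrite /= lt_min i0.
  by rewrite subsetI; split; apply: Amono; rewrite ge_min lexx ?orbT.
have [u [_ Fu]] := cptU F FF filterT.
exists u => d d0; apply: (Acl d d0) => B Bu.
by apply: Fu => //; exists d.
Qed.

Section Orbits.
Context {R : realType} {X : metricType R}.

(** For negative times the relation has to be solved backwards, which only
    takes the injectivity of [T]. *)
Lemma iterz_orbit (T : {splitbij [set: X] >-> [set: X]}) (x : int -> X) :
  (forall n : int, T (x n) = x (n + 1)) ->
  forall n : int, x n = iterz T n (x 0).
Proof.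
move=> xT; have Tinj y z : T y = T z -> y = z.
  by move=> /(congr1 (T^-1)%FUN); rewrite !funK ?inE.
elim/int_rect => [//|n IH|n IH].
  by rewrite intS addrC -xT iterzS IH.
by apply: Tinj; rewrite xT -iterzS intS opprD addrAC addNr add0r.
Qed.

Lemma pseudo_orbit_iterz (T : {splitbij [set: X] >-> [set: X]}) (delta : R)
    (x : X) :
  0 < delta -> pseudo_orbit T delta (fun n => iterz T n x).
Proof. by move=> d0 n; rewrite iterzS mdistxx. Qed.

Lemma pseudo_orbit_shift (T : X -> X) (delta : R) (x : int -> X) (m : int) :
  pseudo_orbit T delta x -> pseudo_orbit T delta (fun n => x (m + n)).
Proof. by move=> xT n; rewrite addrA; exact: xT. Qed.

(** Compactness turns approximate orbits into exact ones: closed constraints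
    on the positions at each time that can be met by pairs of pseudo orbits of
    arbitrary precision can be met by a pair of orbits. In the product topology
    the error made at each step is a continuous function of the sequence, since
    it only involves two coordinates. *)
Lemma orbit_pair_of_pseudo_orbit_pairs (T : X -> X) (C : int -> set (X * X)) :
  compact [set: X] -> continuous T -> (forall n, closed (C n)) ->
  (forall delta : R, 0 < delta ->
     exists xy : (int -> X) * (int -> X),
       [/\ pseudo_orbit T delta xy.1, pseudo_orbit T delta xy.2 &
           forall n, C n (xy.1 n, xy.2 n)]) ->
  exists x y : int -> X,
    [/\ forall n, T (x n) = x (n + 1), forall n, T (y n) = y (n + 1) &
        forall n, C n (x n, y n)].
Proof.
move=> cptX Tc Ccl exd.
pose U := prod_topology (fun _ : int => (X * X)%type).
have cptU : compact [set: U].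
  have cptXX : compact [set: X * X] by rewrite -setXTT; exact: compact_setX.
  have := @tychonoff _ (fun _ : int => (X * X)%type) _ (fun=> cptXX).
  by congr (compact _); rewrite eqEsubset.
have evc n : continuous (fun u : U => u n).
  exact: (@proj_continuous int (fun=> (X * X)%type) n).
have ev1 n : continuous (fun u : U => (u n).1).
  move=> u; apply: (@continuous_comp _ _ _ (fun u : U => u n) fst).
    exact: evc.
  exact: cvg_fst.
have ev2 n : continuous (fun u : U => (u n).2).
  move=> u; apply: (@continuous_comp _ _ _ (fun u : U => u n) snd).
    exact: evc.
  exact: cvg_snd.
pose err1 (n : int) (u : U) := mdist (T (u n).1) (u (n + 1)).1.
pose err2 (n : int) (u : U) := mdist (T (u n).2) (u (n + 1)).2.
have err1c n : continuous (err1 n).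
  apply: continuous_mdist => // u.
  by apply: (@continuous_comp _ _ _ (fun u : U => (u n).1) T);
    [exact: ev1|exact: Tc].
have err2c n : continuous (err2 n).
  apply: continuous_mdist => // u.
  by apply: (@continuous_comp _ _ _ (fun u : U => (u n).2) T);
    [exact: ev2|exact: Tc].
(* The error bounds are large inequalities, so that [A d] is closed. *)
pose A (d : R) : set U := \bigcap_n
  ((err1 n @^-1` [set r | r <= d]) `&` (err2 n @^-1` [set r | r <= d])
   `&` ((fun u : U => u n) @^-1` C n)).
have [u Au] : exists u, forall d, 0 < d -> A d u.
  apply: compact_nested_nonempty => //.
  - move=> d d0; apply: closed_bigI => n _.
    apply: closedI; first apply: closedI.
    + by apply: preimage_closed; [move=> ? _; exact: err1c|exact: closed_le].
    + by apply: preimage_closed; [move=> ? _; exact: err2c|exact: closed_le].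
    + by apply: preimage_closed; [move=> ? _; exact: evc|exact: Ccl].
  - move=> d d0; have [[x y] [/= xT yT xyC]] := exd d d0.
    exists (fun n => (x n, y n)) => n _.
    by split; [split; apply/ltW; [exact: xT|exact: yT]|exact: xyC].
  - move=> d d' dd' v Av n _; have [[/= e1 e2] Cv] := Av n I.
    by split => //; split; [exact: le_trans e1 dd'|exact: le_trans e2 dd'].
have mdist_small (a b : X) : (forall d, 0 < d -> mdist a b <= d) -> a = b.
  move=> ab; apply: mdist_positivity; apply/eqP.
  rewrite eq_le mdist_ge0 andbT; apply/ler_addgt0Pl => d d0.
  by rewrite addr0; exact: ab.
exists (fun n => (u n).1), (fun n => (u n).2); split => n.
- by apply: mdist_small => d d0; have [[]] := Au d d0 n I.
- by apply: mdist_small => d d0; have [[]] := Au d d0 n I.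
- by have [_ /=] := Au 1 ltr01 n I; case: (u n).
Qed.

End Orbits.

Theorem proposition3p1 (R : realType) (X : metricType R)
    (T : {splitbij [set: X] >-> [set: X]}) (alpha : R)
    (compactX : compact [set: X]) (homeoT : homeomorphism T)
    (alpha_gt0 : 0 < alpha) :
  expansive T alpha <->
  (forall eps : R, 0 < eps ->
     exists2 delta : R, 0 < delta &
       forall x y : int -> X,
         pseudo_orbit T delta x -> pseudo_orbit T delta y ->
         (forall n : int, mdist (x n) (y n) <= alpha) ->
         forall n : int, mdist (x n) (y n) < eps).
Proof.
split=> [expT eps eps0|unifT x y xy]; last first.
  apply: mdist_positivity; apply/eqP.
  rewrite eq_le mdist_ge0 andbT; apply/ler_addgt0Pl => eps eps0.
  rewrite addr0; have [delta delta0 close] := unifT eps eps0.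
  have xo z := pseudo_orbit_iterz T delta z delta0.
  exact/ltW/(close _ _ (xo x) (xo y) xy 0).
apply: contrapT => /forall2NP noT.
(* The separation by [eps] is imposed at time 0 only; the shift of time below
   brings it there. *)
pose C (n : int) : set (X * X) := [set p | mdist p.1 p.2 <= alpha] `&`
  [set p | n = 0 -> eps <= mdist p.1 p.2].
have Ccl n : closed (C n).
  apply: closedI.
    apply: (@preimage_closed _ _ (fun p : X * X => mdist p.1 p.2)
      [set r | r <= alpha]); last exact: closed_le.
    by move=> ? _; exact: mdist_continuous.
  have [->|n0] := eqVneq n 0; last first.
    suff -> : [set p : X * X | n = 0 -> eps <= mdist p.1 p.2] = setT.
      exact: closedT.
    by apply/seteqP; split => // p _ /= /eqP; rewrite (negPf n0).
  suff -> : [set p : X * X | 0 = 0 :> int -> eps <= mdist p.1 p.2] =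
      (fun p : X * X => mdist p.1 p.2) @^-1` [set r | eps <= r].
    apply: preimage_closed; last exact: closed_ge.
    by move=> ? _; exact: mdist_continuous.
  by apply/seteqP; split => p /=; [exact|].
have [|x [y [xT yT xyC]]] :=
    orbit_pair_of_pseudo_orbit_pairs T C compactX homeoT.1 Ccl.
  move=> delta delta0; have [//|] := noT delta.
  move=> /existsNP[x] /existsNP[y] /not_implyP[xT] /not_implyP[yT].
  move=> /not_implyP[xy] /existsNP[m] /negP; rewrite -leNgt => epsm.
  exists (fun n => x (m + n), fun n => y (m + n)).
  split; [exact: pseudo_orbit_shift|exact: pseudo_orbit_shift|].
  by move=> n; split=> [|/= ->]; [exact: xy|rewrite addr0].
have x0y0 : x 0 = y 0.
  apply: expT => n; rewrite -(iterz_orbit T x xT) -(iterz_orbit T y yT).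
  by have [] := xyC n.
have [_ /(_ erefl) /=] := xyC 0.
by rewrite x0y0 mdistxx leNgt eps0.
Qed.
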